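(* (1) Let $f$ be a TFPL with boundary $(u^+,v;w)$ and let $u$ be a binary word such that $u\stackrel{\mathrm{h}}{\longrightarrow}u^+$. Then $\mathrm{WR}_v(\mathrm{WL}_{u}(f))=f$. (2) Let $f$ be a TFPL with boundary $(u,v^+;w)$ and let $v$ be a binary word such that $v\stackrel{\mathrm{v}}{\longrightarrow}v^+$. Then $\mathrm{WL}_u(\mathrm{WR}_{v}(f))=f$.
   Context: The graph $G^N$ ($N\ge1$): the induced subgraph of the square grid made up of $N$ consecutive centered rows of $3,5,\dots,2N+1$ vertices from top to bottom, together with $2N+1$ vertical external edges hanging down from the $2N+1$ vertices of the bottom row (their lower endpoints are not counted as vertices). $\mathcal{L}^N=\{L_1,\dots,L_N\}$ (resp. $\mathcal{R}^N=\{R_1,\dots,R_N\}$) is the set of leftmost (resp. rightmost) vertices of the rows, numbered from left to right; so $L_1$ and $R_N$ lie in the bottom row, $L_N$ and $R_1$ in the top row. The cells of $G^N$ are its $N(N+1)$ unit squares, including the $2N$ external squares below the bottom row, each of which has only three surrounding edges (top, left, right). Cells are partitioned chessboard-wise into odd and even cells, the top left cell being odd. A TFPL (triangular fully packed loop configuration) of size $N$ is a subgraph $f$ of $G^N$ such that: (i) exactly every other external edge, starting with the second from the left, belongs to $f$; (ii) the vertices in $\mathcal{L}^N\cup\mathcal{R}^N$ have degree 0 or 1; (iii) all other vertices of $G^N$ have degree 2; (iv) no path in $f$ connects two vertices of $\mathcal{L}^N$ or two vertices of $\mathcal{R}^N$. The boundary of a TFPL $f$ of size $N$ is the triple $(u,v;w)$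 of binary words (words in $\{0,1\}$) of length $N$ with: $u_i=1$ iff $L_i$ has degree 1; $v_i=1$ iff $R_i$ has degree 0; $w_i=1$ iff the $i$-th external edge in $f$ (from left to right) is connected by a path in $f$ either with a vertex in $\mathcal{L}^N$ or with an external edge to its left. For binary words $\sigma,\tau$ with the same number of zeros and the same number of ones, $\sigma\stackrel{\mathrm{h}}{\longrightarrow}\tau$ means: for every $j$, if $\sigma_i$ is the $j$-th one in $\sigma$ then $\tau_{i-1}$ or $\tau_i$ is the $j$-th one in $\tau$. And $\sigma\stackrel{\mathrm{v}}{\longrightarrow}\tau$ means: for every $j$, if $\sigma_i$ is the $j$-th zero in $\sigma$ then $\tau_i$ or $\tau_{i+1}$ is the $j$-th zero in $\tau$. (Equivalently, the skew shape $\lambda(\tau)/\lambda(\sigma)$ of associated Young diagrams is a horizontal, resp. vertical, strip.) Wieland gyration of a cell: if the cell contains precisely two edges of the configuration and these lie on opposite sides, it is unchanged; otherwise edges and non-edges among its surrounding edges are exchanged. Left-Wieland gyration: let $f$ be a TFPL with left boundary word $u$ and let $u^-\stackrel{\mathrm{h}}{\longrightarrow}u$. $\mathrm{WL}_{u^-}(f)$ is obtained as follows. (1) Insert a vertex $L'_i$ to the left of $L_i$ for $1\le i\le N$. Let $i_1<i_2<\cdots$ be the positions of the ones in $u^-$. For each $j$: if $u_{i_j}$ is the $j$-th one in $u$, add a horizontal edge between $L'_{i_j}$ and $L_{i_j}$; if $u_{i_j-1}$ is the $j$-th one in $u$, add a vertical edge between $L'_{i_j}$ and $L_{i_j-1}$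 (which lies directly below $L'_{i_j}$). (2) Apply Wieland gyration to each odd cell of $f$. (3) Delete all vertices in $\mathcal{R}^N$ and their incident edges. Finally shift everything one unit to the right. Right-Wieland gyration (mirror image): let $f$ be a TFPL with right boundary word $v$ and let $v^-\stackrel{\mathrm{v}}{\longrightarrow}v$. $\mathrm{WR}_{v^-}(f)$ is obtained as follows. (1) Insert a vertex $R'_i$ to the right of $R_i$ for $1\le i\le N$. Let $i_1<i_2<\cdots$ be the positions of the zeros in $v^-$. For each $j$: if $v_{i_j}$ is the $j$-th zero in $v$, add a horizontal edge between $R_{i_j}$ and $R'_{i_j}$; if $v_{i_j+1}$ is the $j$-th zero in $v$, add a vertical edge between $R'_{i_j}$ and $R_{i_j+1}$ (which lies directly below $R'_{i_j}$). (2) Apply Wieland gyration to each even cell of $f$. (3) Delete all vertices in $\mathcal{L}^N$ and their incident edges. Finally shift everything one unit to the left. Known facts making the compositions well defined: if $f$ has boundary $(u,v;w)$, then $\mathrm{WL}_{u^-}(f)$ is a TFPL with boundary $(u^-,v^+;w)$ for some $v^+$ with $v\stackrel{\mathrm{v}}{\longrightarrow}v^+$, and $\mathrm{WR}_{v^-}(f)$ is a TFPL with boundary $(u^+,v^-;w)$ for some $u^+$ with $u\stackrel{\mathrm{h}}{\longrightarrow}u^+$. *)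

(* Defs.v *)
From mathcomp Require Import all_boot all_order all_algebra finmap.

Set Implicit Arguments.
Unset Strict Implicit.
Unset Printing Implicit Defensive.

Import Order.TTheory GRing.Theory Num.Theory.

Local Open Scope fset_scope.
Local Open Scope ring_scope.

(* Triangular fully packed loop configurations.  Everything lives             *)
(* in the square grid on [int * int], so that the insertion of vertices       *)
(* outside G^N and the final translation of a Wieland gyration are literal.   *)
(* A subgraph is the finite set of its edges.                                 *)

Notation vertex := (int * int)%type.

(* [(p, false)] joins p to its right neighbour, [(p, true)] joins p to its    *)
(* upper neighbour.                                                           *)
Notation edge := (int * int * bool)%type.

Definition hor (p : vertex) : edge := (p, false).
Definition ver (p : vertex) : edge := (p, true).

Definition right_of (p : vertex) : vertex := (p.1 + 1, p.2).
Definition left_of (p : vertex) : vertex := (p.1 - 1, p.2).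
Definition above (p : vertex) : vertex := (p.1, p.2 + 1).

Definition src (e : edge) : vertex := e.1.
Definition tgt (e : edge) : vertex := if e.2 then above e.1 else right_of e.1.

Definition incident (e : edge) (p : vertex) : bool := (src e == p) || (tgt e == p).

Definition deg (f : {fset edge}) (p : vertex) : nat :=
  #|` [fset e in f | incident e p]|.

Definition adj (f : {fset edge}) : rel vertex := fun p q =>
  has (fun e => ((src e, tgt e) == (p, q)) || ((src e, tgt e) == (q, p)))
      (enum_fset f).

Definition connected (f : {fset edge}) (p q : vertex) : Prop :=
  exists s : seq vertex, [/\ path (adj f) p s, uniq (p :: s) & last p s = q].

(* The rows of G^N are numbered from bottom (ordinate 1) to top (ordinate N)  *)
(* and the axis of symmetry has abscissa 0: the row at ordinate y consists of *)
(* the 2(N + 1 - y) + 1 vertices with |x| <= N + 1 - y.                       *)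
Definition in_vert (N : nat) (p : vertex) : bool :=
  (1 <= p.2 <= N%:Z) && (`|p.1| <= N%:Z + 1 - p.2).

(* The second disjunct is for the external edges, whose lower endpoints, at   *)
(* ordinate 0, are not vertices of G^N.                                       *)
Definition in_edge (N : nat) (e : edge) : bool :=
  (in_vert N (src e) && in_vert N (tgt e))
  || [&& e.2, (src e).2 == 0 & in_vert N (tgt e)].

(* L_i and R_i, for 1 <= i <= N *)
Definition Lv (N i : nat) : vertex := (i%:Z - N%:Z - 1, i%:Z).
Definition Rv (N i : nat) : vertex := (i%:Z, N%:Z + 1 - i%:Z).

Definition Lset (N : nat) : seq vertex := [seq Lv N i | i <- iota 1 N].
Definition Rset (N : nat) : seq vertex := [seq Rv N i | i <- iota 1 N].

(* the k-th external edge from the left, for 1 <= k <= 2N + 1 *)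
Definition ext_edge (N k : nat) : edge := ver (k%:Z - N%:Z - 1, 0).

Record tfpl (N : nat) (f : {fset edge}) : Prop := Tfpl {
  tfpl_sub : forall e, e \in f -> in_edge N e;
  tfpl_ext : forall k, (1 <= k <= 2 * N + 1)%N -> (ext_edge N k \in f) = ~~ odd k;
  tfpl_bdry : forall p, p \in Lset N ++ Rset N -> (deg f p <= 1)%N;
  tfpl_inner : forall p, in_vert N p -> p \notin Lset N ++ Rset N -> deg f p = 2%N;
  tfpl_L : forall i j, (1 <= i <= N)%N -> (1 <= j <= N)%N -> i <> j ->
    ~ connected f (Lv N i) (Lv N j);
  tfpl_R : forall i j, (1 <= i <= N)%N -> (1 <= j <= N)%N -> i <> j ->
    ~ connected f (Rv N i) (Rv N j)
}.

(* Letters of words are numbered from 1, and [true] stands for 1. *)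
Definition letter (s : seq bool) (i : nat) : bool := nth false s i.-1.

(* the increasing sequence of the positions of the letter b in s *)
Definition positions (b : bool) (s : seq bool) : seq nat :=
  [seq i <- iota 1 (size s) | letter s i == b].

Definition same_content (s t : seq bool) : Prop :=
  count_mem true s = count_mem true t /\ count_mem false s = count_mem false t.

Definition hstep (s t : seq bool) : Prop :=
  same_content s t /\
  forall j, (j < size (positions true s))%N ->
    let i := nth 0%N (positions true s) j in
    let k := nth 0%N (positions true t) j in
    k = i.-1 \/ k = i.

Definition vstep (s t : seq bool) : Prop :=
  same_content s t /\
  forall j, (j < size (positions false s))%N ->
    let i := nth 0%N (positions false s) j in
    let k := nth 0%N (positions false t) j in
    k = i \/ k = i.+1.

Definition lword (N : nat) (f : {fset edge}) : N.-tuple bool :=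
  [tuple deg f (Lv N i.+1) == 1%N | i < N].

Definition rword (N : nat) (f : {fset edge}) : N.-tuple bool :=
  [tuple deg f (Rv N i.+1) == 0%N | i < N].

(* The i-th external edge of a TFPL is the 2i-th external edge of G^N.  An    *)
(* external edge is connected to something when its upper endpoint is.        *)
Definition ext_top (N i : nat) : vertex := tgt (ext_edge N (2 * i)).

Definition boundary (N : nat) (f : {fset edge}) (u v w : N.-tuple bool) : Prop :=
  [/\ u = lword N f, v = rword N f
    & forall i, (1 <= i <= N)%N ->
        letter w i <->
          (exists2 p, p \in Lset N & connected f (ext_top N i) p)
          \/ (exists2 j, (1 <= j < i)%N & connected f (ext_top N i) (ext_top N j))].

(* A cell is represented by its lower left corner.                            *)
Definition cells (N : nat) : seq vertex :=
  [seq (k%:Z - (N - y)%:Z, y%:Z) | y <- iota 0 N, k <- iota 0 (2 * (N - y))].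

(* The top left cell (-1, N - 1) is odd. *)
Definition odd_cell (N : nat) (c : vertex) : bool :=
  (c.1 + c.2 == N%:Z %[mod 2])%Z.

(* Only edges of G^N surround a cell: there are three for an external cell.   *)
Definition sides (N : nat) (c : vertex) : {fset edge} :=
  [fset e in [:: hor c; hor (above c); ver c; ver (right_of c)] | in_edge N e].

Definition gyrate_cell (N : nat) (f : {fset edge}) (c : vertex) : {fset edge} :=
  let g := f `&` sides N c in
  if (g == [fset hor c; hor (above c)]) || (g == [fset ver c; ver (right_of c)])
  then f
  else (f `\` sides N c) `|` (sides N c `\` f).

(* Distinct cells of the same parity have no common side, so the order in     *)
(* which they are treated is immaterial.                                      *)
Definition gyrate (N : nat) (cs : seq vertex) (f : {fset edge}) : {fset edge} :=
  foldl (gyrate_cell N) f cs.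

Definition delete (ps : seq vertex) (f : {fset edge}) : {fset edge} :=
  [fset e in f | (src e \notin ps) && (tgt e \notin ps)].

Definition translate (h : vertex -> vertex) (f : {fset edge}) : {fset edge} :=
  [fset (h e.1, e.2) | e in f].

(* For i the position of the j-th one of u^- and k that of the j-th one of u, *)
(* the edge between L'_i = left_of L_i and L_i if k = i, and the one between  *)
(* L'_i and L_(i-1) if k = i - 1.                                             *)
Definition left_added (N : nat) (ik : nat * nat) : seq edge :=
  let: (i, k) := ik in
  if k == i then [:: hor (left_of (Lv N i))]
  else if k.+1 == i then [:: ver (Lv N i.-1)]
  else [::].

(* For i the position of the j-th zero of v^- and k that of the j-th zero of  *)
(* v, the edge between R_i and R'_i = right_of R_i if k = i, and the one      *)
(* between R'_i and R_(i+1) if k = i + 1.                                     *)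
Definition right_added (N : nat) (ik : nat * nat) : seq edge :=
  let: (i, k) := ik in
  if k == i then [:: hor (Rv N i)]
  else if k == i.+1 then [:: ver (Rv N i.+1)]
  else [::].

Definition left_insert (N : nat) (um : N.-tuple bool) (f : {fset edge}) :
    {fset edge} :=
  f `|` [fset e in flatten [seq left_added N ik |
           ik <- zip (positions true um) (positions true (lword N f))]].

Definition right_insert (N : nat) (vm : N.-tuple bool) (f : {fset edge}) :
    {fset edge} :=
  f `|` [fset e in flatten [seq right_added N ik |
           ik <- zip (positions false vm) (positions false (rword N f))]].

(* WL and WR are total functions; they are the Wieland gyrations when f is a  *)
(* TFPL with [hstep um (lword N f)], resp. [vstep vm (rword N f)].            *)
Definition WL (N : nat) (um : N.-tuple bool) (f : {fset edge}) : {fset edge} :=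
  translate right_of
    (delete (Rset N)
      (gyrate N [seq c <- cells N | odd_cell N c] (left_insert um f))).

Definition WR (N : nat) (vm : N.-tuple bool) (f : {fset edge}) : {fset edge} :=
  translate left_of
    (delete (Lset N)
      (gyrate N [seq c <- cells N | ~~ odd_cell N c] (right_insert vm f))).

(* Main.v *)
Require Import Defs.
From mathcomp Require Import all_boot all_order all_algebra finmap zify.

(* Each edge of G^N that is not incident to a vertex R_i is a side of exactly *)
(* one odd cell, and translation by one unit to the right maps the odd cells  *)
(* bijectively onto the even ones.  Hence WR (WL f) amounts to: insert the    *)
(* edges on the left, gyrate the odd cells, exchange the edges at the R_i     *)
(* for those inserted on the right, gyrate the same cells again, and delete   *)
(* the edges on the left.  Gyration is an involution, because exactly one of  *)
(* the two vertical sides of an external cell is present, so the point is     *)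
(* that the edges inserted on the right are the ones just deleted.            *)
(*   The right neighbour of the vertex M_i = R_i - (1, 0) is R_i, its upper   *)
(* neighbour is R_(i-1), and M_i is the top right corner of an odd cell.      *)
(* Since M_i has degree 2, gyrating this cell gives R_i the degree            *)
(* [M_i R_i in f] + [M_i R_(i-1) in f] in WL f, while its degree in f is      *)
(* [M_i R_i in f] + [M_(i+1) R_i in f].  The edges of f at the R_i, listed    *)
(* as M_1 R_1, M_2 R_1, M_2 R_2, M_3 R_2, ..., therefore enumerate the zeros  *)
(* of both right boundary words in order, and this determines the insertion.  *)
(* No two consecutive edges of the list are in f, by the degree condition at  *)
(* R_i and because f does not connect R_(i-1) with R_i.                       *)
(*   Part (2) is the mirror image.                                            *)

Set Implicit Arguments.
Unset Strict Implicit.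
Unset Printing Implicit Defensive.

Import Order.TTheory GRing.Theory Num.Theory.

Local Open Scope fset_scope.
Local Open Scope ring_scope.

(** The second insertion undoes the first deletion, which leaves two successive gyrations of the
    same cells. [right_insert_delete] and [left_insert_delete] show that inserting along the
    boundary word of [f] restores the deleted edges. They rest on the degree counts [deg_gyr_Rv] and
    [deg_gyr_Lv] and on [mem_zip_positions], which reads both words off one list of edges.
    [gyr_translate] moves the second gyration onto the cells of the first, [gyr_involutive] cancels
    the two, and [delete_left_outer] and [delete_right_outer] remove the edges inserted first. *)

(** * Vertices, edges and cells in coordinates *)

Lemma mem_Rset N p : (p \in Rset N) = (1 <= p.1 <= N%:Z) && (p.2 == N%:Z + 1 - p.1).
Proof.
case: p => x y /=; apply/mapP/idP => [[i]|].
  by rewrite mem_iota /Rv => ? [-> ->]; lia.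
by move=> h; exists `|x|%N; [rewrite mem_iota; lia | rewrite /Rv; congr (_, _); lia].
Qed.

Lemma mem_Lset N p : (p \in Lset N) = (1 <= p.2 <= N%:Z) && (p.1 == p.2 - N%:Z - 1).
Proof.
case: p => x y /=; apply/mapP/idP => [[i]|].
  by rewrite mem_iota /Lv => ? [-> ->]; lia.
by move=> h; exists `|y|%N; [rewrite mem_iota; lia | rewrite /Lv; congr (_, _); lia].
Qed.

Lemma mem_cells N c :
  (c \in cells N) =
  (0 <= c.2 < N%:Z) && (c.2 - N%:Z <= c.1 < N%:Z - c.2).
Proof.
case: c => x y /=; apply/allpairsPdep/idP => [[j [k []]]|].
  by rewrite !mem_iota => ? ? [-> ->]; lia.
move=> h; exists `|y|%N, (absz (x + (N%:Z - y))).
by rewrite !mem_iota; split; [lia | lia | congr (_, _); lia].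
Qed.

Lemma cells_uniq N : uniq (cells N).
Proof.
apply: allpairs_uniq_dep => [||[j k] [j' k'] /=]; first exact: iota_uniq.
  by move=> j _; exact: iota_uniq.
move=> _ _ [] e1 e2; have -> : j = j' by lia.
by congr existT; lia.
Qed.

(** Rows widen downwards, so the upper endpoint decides for a vertical edge; [y = 0] gives the
    external edges. *)
Lemma in_edgeE N x y b : in_edge N ((x, y), b) =
  (if b then [&& 0 <= y, y + 1 <= N%:Z & `|x| <= N%:Z - y]
   else [&& 1 <= y, y <= N%:Z, - (N%:Z + 1 - y) <= x & x <= N%:Z - y]).
Proof. rewrite /in_edge /in_vert /src /tgt /=; case: b => /=; lia. Qed.

Lemma in_sides N c e :
  (e \in sides N c) =
  (e \in [:: hor c; hor (above c); ver c; ver (right_of c)]) && in_edge N e.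
Proof. by rewrite /sides !inE. Qed.

Lemma in_edge_sides N c : c \in cells N ->
  [/\ in_edge N (hor c) = (c.2 != 0), in_edge N (hor (above c)),
      in_edge N (ver c) & in_edge N (ver (right_of c))].
Proof.
by case: c => x y; rewrite mem_cells /= !in_edgeE /=; split; lia.
Qed.

(** Two distinct cells with a common side are neighbours, hence of opposite parity. *)
Lemma sides_inj N c c' e : odd_cell N c = odd_cell N c' ->
  e \in sides N c -> e \in sides N c' -> c = c'.
Proof.
case: c c' e => [x y] [x' y'] [[a b] []]; rewrite !in_sides /odd_cell !inE.
  rewrite !xpair_eqE /= => ? ? ?; congr (_, _); lia.
rewrite !xpair_eqE /= => ? ? ?; congr (_, _); lia.
Qed.

Lemma edge_eqE : (forall p q, (hor p == hor q) = (p == q))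
  * (forall p q, (ver p == ver q) = (p == q))
  * (forall p q, (hor p == ver q) = false)
  * (forall p q, (ver p == hor q) = false).
Proof. by do !split=> *; rewrite xpair_eqE ?eqxx ?andbT ?andbF. Qed.

Lemma above_neq p : (above p == p) = false.
Proof. by case: p => x y; rewrite xpair_eqE /=; lia. Qed.

Lemma right_neq p : (right_of p == p) = false.
Proof. by case: p => x y; rewrite xpair_eqE /=; lia. Qed.

(** * Gyration of all cells of one parity *)

Definition opposite N (f : {fset edge}) c :=
  (f `&` sides N c == [fset hor c; hor (above c)])
  || (f `&` sides N c == [fset ver c; ver (right_of c)]).

Lemma opposite_local N (f g : {fset edge}) c :
  {in sides N c, f =i g} -> opposite N f c = opposite N g c.
Proof.
move=> fg; rewrite /opposite; suff -> : f `&` sides N c = g `&` sides N c by [].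
apply/fsetP => e; rewrite !in_fsetI.
by case: (boolP (_ \in sides N c)) => [/fg ->|]; rewrite ?andbF.
Qed.

(** The factor [c.2 != 0] treats the missing bottom side of an external cell as a non-edge. *)
Lemma oppositeE N f c : c \in cells N ->
  opposite N f c =
  let b := (hor c \in f) && (c.2 != 0) in
  let t := hor (above c) \in f in
  let l := ver c \in f in
  let r := ver (right_of c) \in f in
  [&& b, t, ~~ l & ~~ r] || [&& ~~ b, ~~ t, l & r].
Proof.
move=> cN; have [eb et el er] := in_edge_sides cN.
pose S := [:: hor c; hor (above c); ver c; ver (right_of c)].
have key e1 e2 : e1 \in S -> e2 \in S -> (f `&` sides N c == [fset e1; e2]) =
    all (fun e => ((e \in f) && in_edge N e) == ((e == e1) || (e == e2))) S.
  move=> e1S e2S; apply/eqP/allP => [/fsetP h e eS|h].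
    by apply/eqP; move: (h e); rewrite in_fsetI in_sides in_fset2 eS.
  apply/fsetP => e; rewrite in_fsetI in_sides in_fset2.
  have [/h /eqP //|] := boolP (e \in S).
  move=> eS; rewrite andbF; apply/esym/negbTE.
  by apply: contraNN eS => /orP[] /eqP ->.
rewrite /opposite !key ?inE ?eqxx ?orbT // /S /all eb et el er.
rewrite !edge_eqE !(eq_sym c) above_neq right_neq !eqxx ?orbT ?andbT ?andbF /=.
by do 4!case: (_ \in f); case: (c.2 != 0).
Qed.

Lemma in_gyrate_cell N f c e :
  (e \in gyrate_cell N f c) = (e \in f) (+) ((e \in sides N c) && ~~ opposite N f c).
Proof.
rewrite /gyrate_cell -/(opposite N f c); case: opposite; rewrite ?andbF ?addbF //.
by rewrite in_fsetU !in_fsetD; case: (e \in f); case: (e \in sides N c).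
Qed.

Definition gyr N b f := gyrate N [seq c <- cells N | odd_cell N c == b] f.

Lemma gyrate_out N cs f e :
  (forall c, c \in cs -> e \notin sides N c) -> (e \in gyrate N cs f) = (e \in f).
Proof.
rewrite /gyrate; elim: cs f => //= c cs IH f out.
rewrite IH => [|c' c'cs]; last by rewrite out // inE c'cs orbT.
by rewrite in_gyrate_cell (negPf (out c _)) ?mem_head // addbF.
Qed.

(** Cells of equal parity share no side, so [c] is the only cell that toggles [e], and its sides are
    still those of [f] when its turn comes. *)
Lemma gyrate_in N cs f c e :
  uniq cs -> {in cs &, forall c1 c2, odd_cell N c1 = odd_cell N c2} ->
  c \in cs -> e \in sides N c ->
  (e \in gyrate N cs f) = (e \in f) (+) ~~ opposite N f c.
Proof.
rewrite /gyrate; elim: cs f => //= c0 cs IH f /andP[c0cs Ucs] par.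
have neq c1 e1 : c1 \in cs -> e1 \in sides N c1 -> e1 \notin sides N c0.
  move=> c1cs e1c1; apply: contraNN c0cs => e1c0.
  rewrite (sides_inj _ e1c0 e1c1) //.
  by apply: par; rewrite ?mem_head // inE c1cs orbT.
rewrite inE => /predU1P[->|ccs] ec.
  rewrite gyrate_out => [|c1 c1cs]; first by rewrite in_gyrate_cell ec.
  by apply: contraTN ec; exact: neq.
rewrite IH // => [|c1 c2 c1cs c2cs]; last by apply: par; rewrite inE ?c1cs ?c2cs orbT.
rewrite in_gyrate_cell (negPf (neq _ _ ccs ec)) addbF; congr (_ (+) ~~ _).
by apply: opposite_local => e1 /(neq _ _ ccs) /negPf e1c0; rewrite in_gyrate_cell e1c0 addbF.
Qed.

Lemma gyr_in N b f c e : c \in cells N -> odd_cell N c = b -> e \in sides N c ->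
  (e \in gyr N b f) = (e \in f) (+) ~~ opposite N f c.
Proof.
move=> cN cb; apply: gyrate_in; rewrite ?filter_uniq ?cells_uniq ?mem_filter ?cb ?eqxx //.
by move=> c1 c2; rewrite !mem_filter => /andP[/eqP-> _] /andP[/eqP-> _].
Qed.

Lemma gyr_out N b f e :
  (forall c, c \in cells N -> odd_cell N c = b -> e \notin sides N c) ->
  (e \in gyr N b f) = (e \in f).
Proof.
by move=> out; apply: gyrate_out => c; rewrite mem_filter => /andP[/eqP]; auto.
Qed.

Lemma gyrP N b e :
  (exists c, [/\ c \in cells N, odd_cell N c = b & e \in sides N c]) \/
  (forall c, c \in cells N -> odd_cell N c = b -> e \notin sides N c).
Proof.
case: (boolP (has (fun c => (odd_cell N c == b) && (e \in sides N c)) (cells N))).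
  by case/hasP => c cN /andP[/eqP cb ec]; left; exists c.
by move=> /hasPn out; right => c /out; rewrite negb_and => /orP[/eqP|].
Qed.

(** This excludes the failure of involutivity at external cells: with the top side alone, such a
    cell would become a pair of vertical sides, which gyration then fixes. *)
Definition alternating N (f : {fset edge}) :=
  forall x, - N%:Z <= x < N%:Z -> (ver (x, 0) \in f) != (ver (x + 1, 0) \in f).

(** Whether a cell is [opposite] does not change under gyration, so each side is toggled twice or
    never. With four sides, complementation exchanges the two opposite pairs; an external cell with
    exactly one vertical side is never [opposite]. *)
Lemma gyr_involutive N b f : alternating N f -> gyr N b (gyr N b f) = f.
Proof.
move=> alt; apply/fsetP => e.
case: (gyrP N b e) => [[c [cN cb ec]]|out]; last by rewrite !gyr_out.
rewrite !(gyr_in _ cN cb ec) -[RHS]addbF -addbA; congr (_ (+) _).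
have [eb et el er] := in_edge_sides cN.
have in4 e1 : e1 \in [:: hor c; hor (above c); ver c; ver (right_of c)] ->
    in_edge N e1 -> (e1 \in gyr N b f) = (e1 \in f) (+) ~~ opposite N f c.
  by move=> *; apply: gyr_in => //; rewrite in_sides; apply/andP.
suff -> : opposite N (gyr N b f) c = opposite N f c by rewrite addbb.
(* The segment below an external cell is not a side and is not toggled, hence the mask
   [c.2 != 0]. *)
have bot : (hor c \in gyr N b f) && (c.2 != 0) =
    ((hor c \in f) (+) ~~ opposite N f c) && (c.2 != 0).
  have [|c2] := boolP (c.2 == 0); first by rewrite !andbF.
  by rewrite in4 ?eb // !inE eqxx.
rewrite oppositeE // bot (in4 (hor (above c))) ?(in4 (ver _)) ?inE ?eqxx ?orbT //.
rewrite oppositeE //=.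
have [c2|_] := eqVneq c.2 0; last by do 4!case: (_ \in f).
have {}cN : - N%:Z <= c.1 < N%:Z.
  by move: cN; rewrite mem_cells c2; clear; lia.
case: c c2 cN {ec cb eb et el er in4 bot} => x y /= -> /alt.
by rewrite /right_of /= !andbF; do 3!case: (_ \in f).
Qed.

(** * Translation exchanges the parities *)

Lemma mem_translate_right f p b :
  ((p, b) \in translate right_of f) = ((left_of p, b) \in f).
Proof.
apply/imfsetP/idP => [[[[x y] b'] ef [-> ->]]|ef].
  by rewrite /left_of /= addrK.
by exists (left_of p, b) => //=; rewrite /right_of /= subrK; case: p {ef}.
Qed.

Lemma mem_translate_left f p b :
  ((p, b) \in translate left_of f) = ((right_of p, b) \in f).
Proof.
apply/imfsetP/idP => [[[[x y] b'] ef [-> ->]]|ef].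
  by rewrite /right_of /= subrK.
by exists (right_of p, b) => //=; rewrite /left_of /= addrK; case: p {ef}.
Qed.

Lemma translate_leftK : cancel (translate left_of) (translate right_of).
Proof.
move=> f; apply/fsetP => -[[x y] b].
by rewrite mem_translate_right mem_translate_left /right_of /= subrK.
Qed.

Lemma translate_rightK : cancel (translate right_of) (translate left_of).
Proof.
move=> f; apply/fsetP => -[[x y] b].
by rewrite mem_translate_left mem_translate_right /left_of /= addrK.
Qed.

Lemma gyr_translate N g :
  gyr N false (translate right_of g) = translate right_of (gyr N true g).
Proof.
(* In each row the cells alternate, the first being odd and the last even. *)
have shift x y : ((x, y) \in cells N) && odd_cell N (x, y) =
    ((x + 1, y) \in cells N) && ~~ odd_cell N (x + 1, y).
  by rewrite !mem_cells /odd_cell /=; lia.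
have sidesE x y a d b : (x, y) \in cells N -> (x + 1, y) \in cells N ->
    (((a, d), b) \in sides N (x + 1, y)) = (((a - 1, d), b) \in sides N (x, y)).
  rewrite !mem_cells !in_sides !inE !xpair_eqE !in_edgeE /=.
  by case: b => /=; lia.
apply/fsetP => -[[a d] b]; rewrite mem_translate_right /left_of /=.
have [[[x y] [cN cb ec]]|out] := gyrP N true ((a - 1, d), b).
  have := shift x y; rewrite cN cb => /esym /andP[cN' /negPf cb'].
  have ec' : ((a, d), b) \in sides N (x + 1, y) by rewrite sidesE.
  rewrite (gyr_in g cN cb ec) (gyr_in (translate right_of g) cN' cb' ec').
  rewrite mem_translate_right !oppositeE //= !mem_translate_right /left_of /=.
  by rewrite !addrK.
rewrite !gyr_out ?mem_translate_right // => -[x y] cN cb.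
have := shift (x - 1) y; rewrite subrK cN cb => /andP[cN' cb'].
have := sidesE (x - 1) y a d b; rewrite subrK => -> //; exact: out.
Qed.

(** * Pairing the positions of a letter in two words *)

Lemma mem_zip_swap (T U : eqType) (s : seq T) (t : seq U) x y :
  ((x, y) \in zip s t) = ((y, x) \in zip t s).
Proof.
by elim: s t => [|a s IH] [|b t] //=; rewrite !inE !xpair_eqE IH andbC.
Qed.

(* Both words are read off the list r 1, p 2, r 2, p 3, ..., r n: its true    *)
(* entries enumerate the b's of s and of t simultaneously, r j contributing   *)
(* (j, j) and p j.+1 contributing (j, j.+1).                                  *)
Lemma mem_zip_positions n b (s t : n.-tuple bool) (r p : pred nat) i k :
  p 1%N = false -> p n.+1 = false ->
  (forall j, (0 < j <= n)%N -> (letter s j == b) = r j || p j.+1) ->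
  (forall j, (0 < j <= n)%N -> (letter t j == b) = r j || p j) ->
  (forall j, (0 < j <= n)%N -> ~~ (r j && p j.+1)) ->
  (forall j, (0 < j <= n)%N -> ~~ (r j && p j)) ->
  ((i, k) \in zip (positions b s) (positions b t)) =
  (0 < i <= n)%N && ((k == i) && r i || (k == i.+1) && p i.+1).
Proof.
move=> p1 pn sE tE rp' rp.
pose F j := if r j then [:: (j, j)] else if p j.+1 then [:: (j, j.+1)] else [::].
have [Es Et] : positions b s = unzip1 (flatten [seq F j | j <- iota 1 n]) /\
               positions b t = unzip2 (flatten [seq F j | j <- iota 1 n]).
  rewrite /positions !size_tuple.
  (* For prefixes, a true [p m.+1] has already produced its entry for the [m]-th letter of [s], but
     its partner in [t] is the letter [m.+1]; the extra term makes up for this. *)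
  suff H m : (m <= n)%N ->
      [seq j <- iota 1 m | letter s j == b] =
        unzip1 (flatten [seq F j | j <- iota 1 m]) /\
      [seq j <- iota 1 m | letter t j == b] ++ (if p m.+1 then [:: m.+1] else [::])
        = unzip2 (flatten [seq F j | j <- iota 1 m]).
    by have [-> <-] := H n (leqnn n); rewrite pn cats0.
  elim: m => [_|m IH mn]; first by rewrite /= p1.
  have {IH} [IHs IHt] := IH (ltnW mn).
  have -> : iota 1 m.+1 = iota 1 m ++ [:: m.+1] by rewrite -{1}(addn1 m) iotaD add1n.
  rewrite !filter_cat map_cat flatten_cat /= cats0.
  rewrite /unzip1 /unzip2 !map_cat -/unzip1 -/unzip2 -IHs -IHt.
  rewrite sE ?mn // tE ?mn // /F -!catA.
  have := rp' m.+1; have := rp m.+1; rewrite mn /= => /(_ isT) + /(_ isT).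
  by case: (r m.+1); case: (p m.+1); case: (p m.+2).
rewrite Es Et zip_unzip; apply/flatten_mapP/idP => [[j]|].
  rewrite mem_iota /F => jn.
  case: ifP => [rj|_]; first by rewrite inE => /eqP[-> ->]; rewrite eqxx rj; lia.
  case: ifP => [pj|//]; by rewrite inE => /eqP[-> ->]; rewrite eqxx pj orbT; lia.
case/andP=> ij h; exists i; first by rewrite mem_iota; lia.
have := rp' i ij; rewrite /F; case/orP: h => /andP[/eqP -> h]; rewrite h ?andbT.
  by rewrite mem_head.
by move=> /negPf ->; rewrite mem_head.
Qed.

(** * Degrees, boundary words and inserted edges *)

Lemma degE f x y :
  deg f (x, y) = ((hor (x, y) \in f) + (hor (x - 1, y)%R \in f)
                 + (ver (x, y) \in f) + (ver (x, y - 1)%R \in f))%N.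
Proof.
pose S := [:: hor (x, y); hor (x - 1, y); ver (x, y); ver (x, y - 1)].
have uS : uniq S by rewrite /S /= !inE !edge_eqE !xpair_eqE; lia.
have inS e : incident e (x, y) = (e \in S).
  case: e => [[a d] b]; rewrite /S !inE /incident /src /tgt !xpair_eqE /=.
  by case: b => /=; rewrite ?xpair_eqE /=; lia.
rewrite /deg.
have -> : [fset e in f | incident e (x, y)] = [fset e in [seq e <- S | e \in f]].
  by apply/fsetP => e; rewrite !in_fset [RHS]mem_filter -inS inE /= andbC.
by rewrite card_fseq undup_id ?filter_uniq // size_filter /= addn0 !addnA.
Qed.

Lemma lword_letter N f i : (0 < i <= N)%N ->
  letter (lword N f) i = (deg f (Lv N i) == 1%N).
Proof.
case: i => // i iN.
by rewrite /letter -[i.+1.-1]/(val (Ordinal (iN : i < N)%N)) -tnth_nth tnth_mktuple.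
Qed.

Lemma rword_letter N f i : (0 < i <= N)%N ->
  letter (rword N f) i = (deg f (Rv N i) == 0%N).
Proof.
case: i => // i iN.
by rewrite /letter -[i.+1.-1]/(val (Ordinal (iN : i < N)%N)) -tnth_nth tnth_mktuple.
Qed.

(* All the edges that left_insert can add, whatever the word: those from L'_i *)
(* to L_i for 1 <= i <= N and to L_(i-1) for 1 < i <= N.                      *)
Definition outer_left N (e : edge) :=
  (if e.2 then 1 <= e.1.2 < N%:Z else 1 <= e.1.2 <= N%:Z)
  && (e.1.1 == e.1.2 - N%:Z - (if e.2 then 1 else 2)).

Definition outer_right N (e : edge) :=
  ((if e.2 then 2 else 1) <= e.1.1 <= N%:Z) && (e.1.2 == N%:Z + 1 - e.1.1).

Lemma positions_bound N b (s : N.-tuple bool) i :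
  i \in positions b s -> (0 < i <= N)%N.
Proof. by rewrite mem_filter mem_iota size_tuple => /andP[_]; lia. Qed.

Lemma mem_zip (T U : eqType) (s : seq T) (t : seq U) x y :
  (x, y) \in zip s t -> x \in s /\ y \in t.
Proof.
elim: s t => [|a s IH] [|b t] //=; rewrite !inE xpair_eqE.
by case/orP => [/andP[-> ->]|/IH [-> ->]]; rewrite ?orbT.
Qed.

Lemma in_left_insert N (u : N.-tuple bool) f e :
  (e \in left_insert u f) = (e \in f) ||
  has (fun ik => e \in left_added N ik)
    (zip (positions true u) (positions true (lword N f))).
Proof.
rewrite /left_insert in_fsetU; congr (_ || _); rewrite inE /=.
by apply/flatten_mapP/hasP => -[ik ? ?]; exists ik.
Qed.

Lemma in_right_insert N (v : N.-tuple bool) f e :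
  (e \in right_insert v f) = (e \in f) ||
  has (fun ik => e \in right_added N ik)
    (zip (positions false v) (positions false (rword N f))).
Proof.
rewrite /right_insert in_fsetU; congr (_ || _); rewrite inE /=.
by apply/flatten_mapP/hasP => -[ik ? ?]; exists ik.
Qed.

(** Later lemmas take any [f1] lying between [f] and [f] enlarged by outer edges; this bound lets
    them apply to [left_insert u f]. *)
Lemma left_insert_outer N (u : N.-tuple bool) f e :
  e \in left_insert u f -> (e \in f) || outer_left N e.
Proof.
rewrite in_left_insert => /orP[-> //|/hasP[[i k] /mem_zip[]]].
move=> /positions_bound iN /positions_bound kN; rewrite /left_added.
case: eqP => [_|_].
  by rewrite inE => /eqP ->; apply/orP; right; rewrite /outer_left /=; lia.
case: eqP => // ki.
by rewrite inE => /eqP ->; apply/orP; right; rewrite /outer_left /=; lia.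
Qed.

Lemma right_insert_outer N (v : N.-tuple bool) f e :
  e \in right_insert v f -> (e \in f) || outer_right N e.
Proof.
rewrite in_right_insert => /orP[-> //|/hasP[[i k] /mem_zip[]]].
move=> /positions_bound iN /positions_bound kN; rewrite /right_added.
case: eqP => [_|_].
  by rewrite inE => /eqP ->; apply/orP; right; rewrite /outer_right /=; lia.
case: eqP => // ki.
by rewrite inE => /eqP ->; apply/orP; right; rewrite /outer_right /=; lia.
Qed.

(** * Edges at the left and right vertices *)

Definition touches (ps : seq vertex) (e : edge) := (src e \in ps) || (tgt e \in ps).

Lemma mem_delete ps f e : (e \in delete ps f) = (e \in f) && ~~ touches ps e.
Proof. by rewrite /delete in_fset inE /= negb_or. Qed.

Lemma touches_Rset N x y b : touches (Rset N) ((x, y), b) =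
  (1 <= x <= N%:Z) && (y == N%:Z + 1 - x)
  || (if b then (1 <= x <= N%:Z) && (y == N%:Z - x)
      else (0 <= x < N%:Z) && (y == N%:Z - x)).
Proof. by rewrite /touches !mem_Rset /src /tgt /=; case: b => /=; lia. Qed.

Lemma touches_Lset N x y b : touches (Lset N) ((x, y), b) =
  (1 <= y <= N%:Z) && (x == y - N%:Z - 1)
  || (if b then (0 <= y < N%:Z) && (x == y - N%:Z)
      else (1 <= y <= N%:Z) && (x == y - N%:Z - 2)).
Proof. by rewrite /touches !mem_Lset /src /tgt /=; case: b => /=; lia. Qed.

(** An edge of G^N at some R_i is a side only of the last cell of a row, which is even. *)
Lemma gyr_touches_Rset N f e :
  touches (Rset N) e -> (e \in gyr N true f) = (e \in f).
Proof.
case: e => [[x y] b]; rewrite touches_Rset => eR; apply: gyr_out => -[a d].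
rewrite mem_cells /odd_cell in_sides /= !inE !xpair_eqE => cN cb.
by case: b eR => /= eR; lia.
Qed.

(** An edge of G^N at some L_i is a side only of the first cell of a row, which is odd. *)
Lemma gyr_touches_Lset N f e :
  touches (Lset N) e -> (e \in gyr N false f) = (e \in f).
Proof.
case: e => [[x y] b]; rewrite touches_Lset => eL; apply: gyr_out => -[a d].
rewrite mem_cells /odd_cell in_sides /= !inE !xpair_eqE => cN cb.
by case: b eL => /= eL; lia.
Qed.

Lemma gyr_outside N b f e : ~~ in_edge N e -> (e \in gyr N b f) = (e \in f).
Proof. by move=> eN; apply: gyr_out => c _ _; rewrite in_sides negb_and eN orbT. Qed.

(** * Local consequences of the TFPL conditions *)

Lemma tfpl_notin N f e : tfpl N f -> ~~ in_edge N e -> (e \in f) = false.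
Proof. by move=> tf; apply: contraNF; exact: tfpl_sub. Qed.

Lemma adj_edge f e : e \in f -> adj f (src e) (tgt e) && adj f (tgt e) (src e).
Proof. by move=> ef; apply/andP; split; apply/hasP; exists e => //; rewrite !eqxx ?orbT. Qed.

Lemma connected_two_steps f p m q : adj f p m -> adj f m q -> uniq [:: p; m; q] ->
  connected f p q.
Proof. by move=> pm mq u; exists [:: m; q]; split => //=; rewrite pm mq. Qed.

Lemma tfpl_ext_vert N f x : tfpl N f -> - N%:Z <= x <= N%:Z ->
  (ver (x, 0) \in f) = ~~ odd (absz (x + N%:Z + 1)).
Proof.
move=> tf xN; rewrite -(tfpl_ext tf); last by lia.
by rewrite /ext_edge; congr (ver (_, _) \in f); lia.
Qed.

Lemma tfpl_alternating N f f1 out : tfpl N f ->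
  {subset f <= f1} -> (forall e, e \in f1 -> (e \in f) || out e) ->
  (forall x, - N%:Z <= x <= N%:Z -> ~~ out (ver (x, 0))) ->
  alternating N f1.
Proof.
move=> tf ff1 f1f nout x xN.
have ext z : - N%:Z <= z <= N%:Z -> (ver (z, 0) \in f1) = ~~ odd (absz (z + N%:Z + 1)).
  move=> zN; rewrite -(tfpl_ext_vert tf zN); apply/idP/idP => [/f1f|/ff1 //].
  by rewrite (negPf (nout z zN)) orbF.
by rewrite !ext; lia.
Qed.

(** The edges to the right of and above R_i leave G^N. The lower edge is written as the one going up
    from M_(i+1), to match the list of edges M_1 R_1, M_2 R_1, M_2 R_2, ... *)
Lemma deg_tfpl_Rv N f i : tfpl N f -> (0 < i <= N)%N ->
  deg f (Rv N i) = ((hor (i%:Z - 1, N%:Z + 1 - i%:Z)%R \in f)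
                    + (ver (i.+1%:Z - 1, N%:Z + 1 - i.+1%:Z)%R \in f))%N.
Proof.
move=> tf iN; rewrite /Rv degE.
rewrite !(tfpl_notin (e := _ (i%:Z, N%:Z + 1 - i%:Z)) tf) ?in_edgeE /=; try lia.
by rewrite add0n addn0; congr (_ + (ver (_, _) \in f))%N; lia.
Qed.

Lemma deg_tfpl_Lv N f i : tfpl N f -> (0 < i <= N)%N ->
  deg f (Lv N i) = ((hor (i%:Z - N%:Z - 1, i%:Z)%R \in f)
                    + (ver (i%:Z - N%:Z - 1, i%:Z - 1)%R \in f))%N.
Proof.
move=> tf iN; rewrite /Lv degE (tfpl_notin (e := ver (_, i%:Z)) tf) ?in_edgeE /=; last lia.
by rewrite (tfpl_notin (e := hor (_ - 1 - 1, i%:Z)) tf) ?in_edgeE /= ?addn0 //; lia.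
Qed.

(** Both edges together would form the path R_i, M_i, R_(i-1); for [i = 1] the vertical one leaves
    G^N. *)
Lemma tfpl_R_path N f i : tfpl N f -> (0 < i <= N)%N ->
  ~~ ((hor (i%:Z - 1, N%:Z + 1 - i%:Z) \in f)
      && (ver (i%:Z - 1, N%:Z + 1 - i%:Z) \in f)).
Proof.
move=> tf; case: i => [//|[|i]] iN.
  by rewrite (tfpl_notin (e := ver _) tf) ?andbF // in_edgeE; lia.
apply/negP => /andP[/adj_edge /andP[_ h1] /adj_edge /andP[h2 _]].
apply: (tfpl_R tf (i := i.+2) (j := i.+1)); try lia.
have -> : Rv N i.+2 = tgt (hor (i.+2%:Z - 1, N%:Z + 1 - i.+2%:Z)).
  by congr (_, _) => /=; lia.
have -> : Rv N i.+1 = tgt (ver (i.+2%:Z - 1, N%:Z + 1 - i.+2%:Z)).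
  by congr (_, _) => /=; lia.
apply: connected_two_steps h1 h2 _.
by rewrite /= !inE /src /tgt /= !xpair_eqE /=; lia.
Qed.

Lemma tfpl_L_path N f i : tfpl N f -> (0 < i <= N)%N ->
  ~~ ((hor (i%:Z - N%:Z - 1, i%:Z) \in f) && (ver (i%:Z - N%:Z, i%:Z) \in f)).
Proof.
move=> tf iN; have [iltN|Nlei] := ltnP i N; last first.
  by rewrite (tfpl_notin (e := ver _) tf) ?andbF // in_edgeE; lia.
apply/negP => /andP[/adj_edge /andP[h1 _] /adj_edge /andP[h2 _]].
apply: (tfpl_L tf (i := i) (j := i.+1)); try lia.
have -> : Lv N i.+1 = tgt (ver (i%:Z - N%:Z, i%:Z)).
  by congr (_, _) => /=; lia.
apply: (connected_two_steps h1); first by rewrite /tgt /= /right_of /= subrK.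
by rewrite /= !inE /src /tgt /= !xpair_eqE /=; lia.
Qed.

(** * Boundary degrees after gyration *)

(** After deletion and shift, R_i keeps the top and right sides of the odd cell with top right
    corner M_i. If the cell is complemented, two minus their old number remains, which is the number
    of the other two edges of [f] at M_i; if it is [opposite], both numbers are 1. *)
Lemma deg_gyr_Rv N (f f1 : {fset edge}) i : tfpl N f -> {subset f <= f1} ->
  (forall e, e \in f1 -> (e \in f) || outer_left N e) -> (0 < i <= N)%N ->
  deg (translate right_of (delete (Rset N) (gyr N true f1))) (Rv N i) =
  ((hor (i%:Z - 1, N%:Z + 1 - i%:Z)%R \in f)
   + (ver (i%:Z - 1, N%:Z + 1 - i%:Z)%R \in f))%N.
Proof.
move=> tf ff1 f1f iN; rewrite /Rv.
have f1E e : outer_left N e = false -> (e \in f1) = (e \in f).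
  by move=> oe; apply/idP/idP => [/f1f|/ff1 //]; rewrite oe orbF.
(* [(x, y)] is M_i, and [(x - 1, y - 1)] is the odd cell below and to the left of it. *)
have [x xE] : exists x : int, x = i%:Z - 1 by exists (i%:Z - 1).
have [y yE] : exists y : int, y = N%:Z + 1 - i%:Z by exists (N%:Z + 1 - i%:Z).
rewrite -xE -yE; have -> : i%:Z = x + 1 by lia.
have {xE yE iN i} xyN : (0 <= x < N%:Z) && (y == N%:Z - x) by lia.
have top : above (x - 1, y - 1) = (x - 1, y) by rewrite /above /= subrK.
have right : right_of (x - 1, y - 1) = (x, y - 1) by rewrite /right_of /= subrK.
have [cN cb xyin xyLR] : [/\ (x - 1, y - 1) \in cells N,
    odd_cell N (x - 1, y - 1) = true, in_vert N (x, y)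
    & (x, y) \notin Lset N ++ Rset N].
  clear -xyN; rewrite mem_cells /odd_cell /in_vert mem_cat mem_Lset mem_Rset /=.
  by split; lia.
have [t_in r_in] : in_edge N (hor (x - 1, y)) /\ in_edge N (ver (x, y - 1)).
  by clear -xyN; rewrite !in_edgeE; split; lia.
have [obot otop oleft oright] : [/\ outer_left N (hor (x - 1, y - 1)) = false,
    outer_left N (hor (x - 1, y)) = false, outer_left N (ver (x - 1, y - 1)) = false
    & outer_left N (ver (x, y - 1)) = false].
  by clear -xyN; rewrite /outer_left /=; split; lia.
have [tR tt tr] : [/\ touches (Rset N) (hor (x, y)),
    touches (Rset N) (hor (x - 1, y)) = false
    & touches (Rset N) (ver (x, y - 1)) = false].
  by clear -xyN; rewrite !touches_Rset; split; lia.
(* The edge above M_i ends at R_(i-1) and is deleted, or [i = 1] and it lies outside G^N. *)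
have up : (ver (x, y) \in gyr N true f1) && ~~ touches (Rset N) (ver (x, y)) = false.
  have [->|[xy_in xy_out]] : touches (Rset N) (ver (x, y)) \/
      ~~ in_edge N (ver (x, y)) /\ outer_left N (ver (x, y)) = false.
  - by clear -xyN; rewrite touches_Rset in_edgeE /outer_left /=; lia.
  - by rewrite andbF.
  by rewrite gyr_outside // f1E // (tfpl_notin tf).
have t_side : hor (x - 1, y) \in sides N (x - 1, y - 1).
  by rewrite in_sides top right t_in !inE eqxx orbT.
have r_side : ver (x, y - 1) \in sides N (x - 1, y - 1).
  by rewrite in_sides top right r_in !inE eqxx !orbT.
have := tfpl_inner tf xyin xyLR.
rewrite !degE !mem_translate_right /left_of /= !addrK !mem_delete up tR tt tr.
rewrite andbF !andbT (gyr_in f1 cN cb t_side) (gyr_in f1 cN cb r_side).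
rewrite oppositeE // top right !f1E //=.
move: (y - 1 != 0) (_ \in f) (_ \in f) (_ \in f) (_ \in f) (_ \in f) (_ \in f).
by do 7!case.
Qed.

(** The same count at the right neighbour of L_i, the top left corner [(x, y)] of an even cell. *)
Lemma deg_gyr_Lv N (f f1 : {fset edge}) i : tfpl N f -> {subset f <= f1} ->
  (forall e, e \in f1 -> (e \in f) || outer_right N e) -> (0 < i <= N)%N ->
  deg (translate left_of (delete (Lset N) (gyr N false f1))) (Lv N i) =
  ((hor (i%:Z - N%:Z - 1, i%:Z)%R \in f) + (ver (i%:Z - N%:Z, i%:Z)%R \in f))%N.
Proof.
move=> tf ff1 f1f iN; rewrite /Lv.
have f1E e : outer_right N e = false -> (e \in f1) = (e \in f).
  by move=> oe; apply/idP/idP => [/f1f|/ff1 //]; rewrite oe orbF.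
have [x xE] : exists x : int, x = i%:Z - N%:Z by exists (i%:Z - N%:Z).
have [y yE] : exists y : int, y = i%:Z by exists i%:Z.
rewrite -xE -yE; have {xE yE iN i} xyN : (0 < y <= N%:Z) && (x == y - N%:Z) by lia.
have top : above (x, y - 1) = (x, y) by rewrite /above /= subrK.
have [cN cb xyin xyLR] : [/\ (x, y - 1) \in cells N,
    odd_cell N (x, y - 1) = false, in_vert N (x, y)
    & (x, y) \notin Lset N ++ Rset N].
  clear -xyN; rewrite mem_cells /odd_cell /in_vert mem_cat mem_Lset mem_Rset /=.
  by split; lia.
have [t_in l_in] : in_edge N (hor (x, y)) /\ in_edge N (ver (x, y - 1)).
  by clear -xyN; rewrite !in_edgeE; split; lia.
have [obot otop oleft oright] : [/\ outer_right N (hor (x, y - 1)) = false,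
    outer_right N (hor (x, y)) = false, outer_right N (ver (x, y - 1)) = false
    & outer_right N (ver (x + 1, y - 1)) = false].
  by clear -xyN; rewrite /outer_right /=; split; lia.
have [tL tt tl] : [/\ touches (Lset N) (hor (x - 1, y)),
    touches (Lset N) (hor (x, y)) = false
    & touches (Lset N) (ver (x, y - 1)) = false].
  by clear -xyN; rewrite !touches_Lset; split; lia.
have up : (ver (x, y) \in gyr N false f1) && ~~ touches (Lset N) (ver (x, y)) = false.
  have [->|[xy_in xy_out]] : touches (Lset N) (ver (x, y)) \/
      ~~ in_edge N (ver (x, y)) /\ outer_right N (ver (x, y)) = false.
  - by clear -xyN; rewrite touches_Lset in_edgeE /outer_right /=; lia.
  - by rewrite andbF.
  by rewrite gyr_outside // f1E // (tfpl_notin tf).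
have t_side : hor (x, y) \in sides N (x, y - 1).
  by rewrite in_sides top t_in !inE eqxx orbT.
have l_side : ver (x, y - 1) \in sides N (x, y - 1).
  by rewrite in_sides top l_in !inE eqxx !orbT.
have := tfpl_inner tf xyin xyLR.
rewrite !degE !mem_translate_left /right_of /= !subrK !mem_delete up tL tt tl.
rewrite andbF !andbT (gyr_in f1 cN cb t_side) (gyr_in f1 cN cb l_side).
rewrite oppositeE // top !f1E //=.
move: (y - 1 != 0) (_ \in f) (_ \in f) (_ \in f) (_ \in f) (_ \in f) (_ \in f).
by do 7!case.
Qed.

(** * Insertion restores the deleted edges *)

Lemma right_insert_delete N (f f1 : {fset edge}) : tfpl N f -> {subset f <= f1} ->
  (forall e, e \in f1 -> (e \in f) || outer_left N e) ->
  right_insert (rword N f)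
    (translate right_of (delete (Rset N) (gyr N true f1))) =
  translate right_of (gyr N true f1).
Proof.
move=> tf ff1 f1f; set h := translate right_of _.
(* [r i] stands for the edge M_i R_i, and [p i] for M_i R_(i-1). *)
pose r i := hor (i%:Z - 1, N%:Z + 1 - i%:Z) \in f.
pose p i := ver (i%:Z - 1, N%:Z + 1 - i%:Z) \in f.
have degf i : (0 < i <= N)%N -> deg f (Rv N i) = (r i + p i.+1)%N.
  exact: deg_tfpl_Rv.
have zipE i k :
    ((i, k) \in zip (positions false (rword N f)) (positions false (rword N h)))
    = (0 < i <= N)%N && ((k == i) && r i || (k == i.+1) && p i.+1).
  apply: mem_zip_positions => [|||||j jN].
  - by rewrite /p (tfpl_notin tf) // in_edgeE; lia.
  (* [p N.+1] is the last external edge, of odd rank [2N + 1], hence absent. *)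
  - rewrite /p (_ : N%:Z + 1 - _ = 0) ?(tfpl_ext_vert tf); lia.
  - by move=> j jN; rewrite rword_letter // degf //; case: (r j); case: (p _).
  - move=> j jN; rewrite rword_letter // (deg_gyr_Rv tf ff1 f1f jN).
    by rewrite -/(r j) -/(p j); case: (r j); case: (p _).
  - move=> j jN; have : (deg f (Rv N j) <= 1)%N.
      by apply: (tfpl_bdry tf); rewrite mem_cat mem_Rset /=; lia.
    by rewrite degf //; case: (r j); case: (p _).
  exact: tfpl_R_path.
have added x y b :
    has (fun ik => ((x, y), b) \in right_added N ik)
      (zip (positions false (rword N f)) (positions false (rword N h))) =
    ((x - 1, y, b) \in f) && touches (Rset N) (x - 1, y, b).
  apply/hasP/andP => [[[i k]]|[ef]].
    rewrite zipE => /andP[iN /orP[] /andP[/eqP ->]]; rewrite /right_added.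
      rewrite eqxx inE => ri /eqP[-> -> ->]; split => //.
      by rewrite touches_Rset; lia.
    rewrite eqxx gtn_eqF // inE => pi /eqP[-> -> ->]; split => //.
    by rewrite touches_Rset; lia.
  have := tfpl_sub tf ef; rewrite touches_Rset in_edgeE.
  case: b ef => ef ein eR.
    (* A vertical edge of abscissa [x - 1] is [p x], which pairs position [x - 1] with [x]. *)
    exists (absz (x - 1), absz x).
      rewrite zipE /p (_ : (absz (x - 1)).+1%:Z = x); last by lia.
      by rewrite (_ : N%:Z + 1 - x = y) ?ef; lia.
    rewrite /right_added; have -> : (absz x == absz (x - 1)) = false by lia.
    have -> : absz x == (absz (x - 1)).+1 by lia.
    by rewrite inE; apply/eqP; congr (_, _, _); lia.
  exists (absz x, absz x).
    rewrite zipE /r (_ : (absz x)%:Z = x); last by lia.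
    by rewrite (_ : N%:Z + 1 - x = y) ?ef; lia.
  by rewrite /right_added eqxx inE; apply/eqP; congr (_, _, _); lia.
apply/fsetP => -[[x y] b].
rewrite in_right_insert added !mem_translate_right mem_delete /left_of /=.
case: (boolP (touches _ _)) => eR; rewrite ?andbT ?andbF ?orbF //=.
rewrite (gyr_touches_Rset _ eR); apply/idP/idP => [/ff1 //|/f1f /orP[//|]].
move: eR; rewrite touches_Rset /outer_left /=; case: b => /=; lia.
Qed.

(** Here [f] has [r j + p j] edges at L_j, and the new configuration [r j + p j.+1]: the two words
    exchange roles compared with the right side, hence [mem_zip_swap]. *)
Lemma left_insert_delete N (f f1 : {fset edge}) : tfpl N f -> {subset f <= f1} ->
  (forall e, e \in f1 -> (e \in f) || outer_right N e) ->
  left_insert (lword N f)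
    (translate left_of (delete (Lset N) (gyr N false f1))) =
  translate left_of (gyr N false f1).
Proof.
move=> tf ff1 f1f; set h := translate left_of _.
pose r i := hor (i%:Z - N%:Z - 1, i%:Z) \in f.
pose p i := ver (i%:Z - N%:Z - 1, i%:Z - 1) \in f.
have degf i : (0 < i <= N)%N -> deg f (Lv N i) = (r i + p i)%N.
  exact: deg_tfpl_Lv.
have pS i : p i.+1 = (ver (i%:Z - N%:Z, i%:Z) \in f).
  by rewrite /p; congr (ver (_, _) \in f); lia.
have zipE i k :
    ((i, k) \in zip (positions true (lword N f)) (positions true (lword N h)))
    = (0 < k <= N)%N && ((i == k) && r k || (i == k.+1) && p k.+1).
  rewrite mem_zip_swap; apply: mem_zip_positions => [|||||j jN].
  (* [p 1] is the first external edge, of odd rank, hence absent. *)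
  - by rewrite /p (_ : 1%:Z - 1 = 0) ?(tfpl_ext_vert tf); lia.
  - by rewrite pS (tfpl_notin tf) // in_edgeE; lia.
  - move=> j jN; rewrite lword_letter // (deg_gyr_Lv tf ff1 f1f jN) -pS.
    have := tfpl_L_path tf jN; rewrite -pS -/(r j).
    by case: (r j); case: (p _).
  - move=> j jN; rewrite lword_letter // degf //.
    have : (deg f (Lv N j) <= 1)%N.
      by apply: (tfpl_bdry tf); rewrite mem_cat mem_Lset /=; lia.
    by rewrite degf //; case: (r j); case: (p _).
  - by move=> j jN; rewrite pS; exact: tfpl_L_path.
  have : (deg f (Lv N j) <= 1)%N.
    by apply: (tfpl_bdry tf); rewrite mem_cat mem_Lset /=; lia.
  by rewrite degf //; case: (r j); case: (p _).
have added x y b :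
    has (fun ik => ((x, y), b) \in left_added N ik)
      (zip (positions true (lword N f)) (positions true (lword N h))) =
    ((x + 1, y, b) \in f) && touches (Lset N) (x + 1, y, b).
  apply/hasP/andP => [[[i k]]|[ef]].
    rewrite zipE => /andP[iN /orP[] /andP[/eqP ->]]; rewrite /left_added.
      rewrite eqxx inE => ri /eqP[-> -> ->]; rewrite subrK; split => //.
      by rewrite touches_Lset; lia.
    rewrite eqxx ltn_eqF // inE pS => pi /eqP[-> -> ->]; rewrite subrK; split => //.
    by have := tfpl_sub tf pi; rewrite touches_Lset in_edgeE; lia.
  have := tfpl_sub tf ef; rewrite touches_Lset in_edgeE.
  case: b ef => ef ein eL.
    have y0 : y != 0.
      apply: contraTneq ef => y0.
      have [-> ->] : x + 1 = - N%:Z /\ y = 0 by lia.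
      by rewrite (tfpl_ext_vert tf); lia.
    exists ((absz y).+1, absz y).
      rewrite zipE pS (_ : (absz y)%:Z = y); last by lia.
      by rewrite (_ : y - N%:Z = x + 1) ?ef; lia.
    rewrite /left_added ltn_eqF // eqxx.
    by rewrite inE; apply/eqP; congr (_, _, _); rewrite /=; lia.
  exists (absz y, absz y).
    rewrite zipE /r (_ : (absz y)%:Z = y); last by lia.
    by rewrite (_ : y - N%:Z - 1 = x + 1) ?ef; lia.
  by rewrite /left_added eqxx inE; apply/eqP; congr (_, _, _); rewrite /=; lia.
apply/fsetP => -[[x y] b].
rewrite in_left_insert added !mem_translate_left mem_delete /right_of /=.
case: (boolP (touches _ _)) => eL; rewrite ?andbT ?andbF ?orbF //=.
rewrite (gyr_touches_Lset _ eL); apply/idP/idP => [/ff1 //|/f1f /orP[//|]].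
move: eL; rewrite touches_Lset /outer_right /=; case: b => /=; lia.
Qed.

(** The shift puts each L'_i in the place of L_i and moves [f] clear of all the L_i. *)
Lemma delete_left_outer N (f f1 : {fset edge}) : tfpl N f -> {subset f <= f1} ->
  (forall e, e \in f1 -> (e \in f) || outer_left N e) ->
  delete (Lset N) (translate right_of f1) = translate right_of f.
Proof.
move=> tf ff1 f1f; apply/fsetP => -[[x y] b].
rewrite mem_delete !mem_translate_right /left_of /=.
apply/andP/idP => [[/f1f /orP[//|]]|ef].
  by rewrite touches_Lset /outer_left /=; case: b => /=; lia.
split; first exact: ff1.
by have := tfpl_sub tf ef; rewrite touches_Lset in_edgeE; case: b {ef} => /=; lia.
Qed.

Lemma delete_right_outer N (f f1 : {fset edge}) : tfpl N f -> {subset f <= f1} ->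
  (forall e, e \in f1 -> (e \in f) || outer_right N e) ->
  delete (Rset N) (translate left_of f1) = translate left_of f.
Proof.
move=> tf ff1 f1f; apply/fsetP => -[[x y] b].
rewrite mem_delete !mem_translate_left /right_of /=.
apply/andP/idP => [[/f1f /orP[//|]]|ef].
  by rewrite touches_Rset /outer_right /=; case: b => /=; lia.
split; first exact: ff1.
by have := tfpl_sub tf ef; rewrite touches_Rset in_edgeE; case: b {ef} => /=; lia.
Qed.

(** * The two compositions *)

Lemma WLE N (u : N.-tuple bool) f : WL u f =
  translate right_of (delete (Rset N) (gyr N true (left_insert u f))).
Proof. by rewrite /gyr; under eq_filter do rewrite eqb_id. Qed.

Lemma WRE N (v : N.-tuple bool) f : WR v f =
  translate left_of (delete (Lset N) (gyr N false (right_insert v f))).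
Proof. by rewrite /gyr; under eq_filter do rewrite eqbF_neg. Qed.

Theorem theorem2 (N : nat) (hN : (0 < N)%N) :
  (forall (f : {fset edge}) (u up v w : N.-tuple bool),
      tfpl N f -> boundary f up v w -> hstep u up ->
      WR v (WL u f) = f)
  /\
  (forall (f : {fset edge}) (u v vp w : N.-tuple bool),
      tfpl N f -> boundary f u vp w -> vstep v vp ->
      WL u (WR v f) = f).
Proof.
split=> [f u _ v w tf [_ -> _] _|f u v _ w tf [-> _ _] _].
  have ff1 : {subset f <= left_insert u f} by move=> e ef; rewrite in_left_insert ef.
  have f1f := @left_insert_outer N u f.
  rewrite WRE WLE (right_insert_delete tf ff1 f1f) gyr_translate gyr_involutive.
    by rewrite (delete_left_outer tf ff1 f1f) translate_rightK.
  by apply: (tfpl_alternating tf ff1 f1f) => x _; rewrite /outer_left /=; lia.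
have ff1 : {subset f <= right_insert v f} by move=> e ef; rewrite in_right_insert ef.
have f1f := @right_insert_outer N v f.
rewrite WLE WRE (left_insert_delete tf ff1 f1f).
(* [gyr_translate] concerns right shifts, so the odd gyration is conjugated into an even one. *)
rewrite -[gyr N true _]translate_rightK -gyr_translate translate_leftK gyr_involutive.
  by rewrite (delete_right_outer tf ff1 f1f) translate_leftK.
by apply: (tfpl_alternating tf ff1 f1f) => x xN; rewrite /outer_right /=; lia.
Qed.
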